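(* Let $\psi$ be as in the context and $\lambda=1$. For each $N\ge1$ let $\sigma_N$ be the first hitting time of the empty set $\emptyset$ by the reversible nearest particle system on $\{1,2,\dots,N\}$ with parameters $\psi$ and $\lambda=1$, started from the initial distribution $\pi$ (defined in the context). Let $\{C_N:N\ge1\}$ be any increasing sequence of numbers with $\lim_{N\to\infty}C_N=\infty$. Then $$\lim_{N\to+\infty}P\left(\frac{N}{C_N}\le\sigma_N\le C_N N^2\right)=1.$$
   Context: Let $\psi:\{1,2,3,\dots\}\to(0,\infty)$ satisfy $\sum_{n=1}^\infty\psi(n)=1$, the ratio $\psi(n)/\psi(n+1)$ is decreasing (non-increasing) in $n$ with limit $1$ as $n\to\infty$, and $\sum_n n^2\psi(n)<\infty$. For $\lambda>0$ define $\beta(l,r)=\lambda\,\psi(l)\psi(r)/\psi(l+r)$ for integers $l,r\ge 1$, $\beta(l,\infty)=\beta(\infty,l)=\lambda\psi(l)$ for integers $l\ge1$, and $\beta(\infty,\infty)=0$. For $A\subset\{1,\dots,N\}$ and $x\in\{1,\dots,N\}\setminus A$, let $l_x(A)$ and $r_x(A)$ be the distances from $x$ to the nearest point of $A$ to the left and to the right of $x$, respectively, with the value $\infty$ if there is no such point. The reversible nearest particle system on $\{1,\dots,N\}$ with parameters $\psi,\lambda$ is the continuous time Markov chain whose state space is the set of all subsets of $\{1,\dots,N\}$, with jump rates $q(A,A\setminus\{x\})=1$ if $x\in A$; $q(A,A\cup\{x\})=\beta(l_x(A),r_x(A))$ if $x\in\{1,\dots,N\}\setminus A$; and $q(A,B)=0$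 for all other $B\ne A$. In particular $\emptyset$ is absorbing. For a non-empty set $A=\{x_1<x_2<\dots<x_k\}\subset\{1,\dots,N\}$ put $\nu_\psi(A)=\psi(x_2-x_1)\psi(x_3-x_2)\cdots\psi(x_k-x_{k-1})$ if $k>1$ and $\nu_\psi(A)=1$ if $k=1$. Let $K_N=\sum_{\emptyset\ne A\subset\{1,\dots,N\}}\nu_\psi(A)$. The probability measure $\pi$ (depending on $N$) on the subsets of $\{1,\dots,N\}$ is given by $\pi(A)=\nu_\psi(A)/K_N$ for $A\neq\emptyset$ and $\pi(\{\emptyset\})=0$. *)

(* Defs.v *)
From HB Require Import structures.
From mathcomp Require Import all_boot all_order all_algebra.
From mathcomp Require Import all_classical all_reals all_analysis.

Set Implicit Arguments.
Unset Strict Implicit.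
Unset Printing Implicit Defensive.

Import Order.TTheory GRing.Theory Num.Theory.
Import numFieldNormedType.Exports.

Local Open Scope classical_set_scope.
Local Open Scope ring_scope.

(* Backward equation p_t' = Q p_t for t > 0 with p_0 the identity, where Q is
   the generator with off-diagonal entries q A B and zero row sums; the diagonal
   values q A A are irrelevant since their contribution cancels. On a finite
   state space the unique solution on [0, +oo[ is p_t = exp(t Q). *)
Record is_transition_function (R : realType) (S : finType)
    (q : S -> S -> R) (p : R -> S -> S -> R) : Prop := IsTransitionFunction {
  transition_at0 : forall A B, p 0 A B = (A == B)%:R ;
  transition_cvg0 : forall A B, p t A B @[t --> 0^'+] --> p 0 A B ;
  transition_backward : forall (t : R) A B, 0 < t ->
    is_derive t 1 (fun s : R => p s A B)
      (\sum_(C : S) q A C * (p t C B - p t A B)) }.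

(* Only the values X t with 0 <= t matter. *)
Record is_markov_chain (R : realType) (S : finType) (q : S -> S -> R)
    (mu : S -> R) (d : measure_display) (T : measurableType d)
    (P : probability T R) (X : R -> T -> S) : Prop := IsMarkovChain {
  chain_measurable : forall (t : R) A, 0 <= t -> measurable [set w | X t w = A] ;
  (* right-continuity of the paths, for the discrete topology on S *)
  chain_rightcont : forall w (t : R), 0 <= t ->
    \forall s \near t^'+, X s w = X t w ;
  chain_fdd : exists2 p : R -> S -> S -> R, is_transition_function q p &
    forall (n : nat) (t : nat -> R) (A : nat -> S),
      t 0%N = 0 -> (forall i j, (i <= j)%N -> t i <= t j) ->
      P [set w | forall i, (i <= n)%N -> X (t i) w = A i] =
      (mu (A 0%N) *
       \prod_(0 <= i < n) p (t i.+1 - t i) (A i) (A i.+1))%:E }.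

Definition hitting_time (R : realType) (S T : Type) (X : R -> T -> S) (a : S)
    (w : T) : \bar R :=
  ereal_inf [set t%:E | t in [set t : R | 0 <= t /\ X t w = a]].

(* The site x of {1, ..., N} is represented by the ordinal x - 1 of 'I_N; only
   differences of sites are used. The distance infinity is None, and psi 0 is
   never used. *)

Definition left_dist (N : nat) (A : {set 'I_N}) (x : 'I_N) : option nat :=
  omap (fun y : 'I_N => (x - y)%N)
    [pick y in A | (y < x)%N && [forall z in A, (z < x)%N ==> (z <= y)%N]].

Definition right_dist (N : nat) (A : {set 'I_N}) (x : 'I_N) : option nat :=
  omap (fun y : 'I_N => (y - x)%N)
    [pick y in A | (x < y)%N && [forall z in A, (x < z)%N ==> (y <= z)%N]].

Definition birth_rate (R : realType) (psi : nat -> R) (lambda : R)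
    (l r : option nat) : R :=
  match l, r with
  | Some l, Some r => lambda * psi l * psi r / psi (l + r)%N
  | Some l, None => lambda * psi l
  | None, Some r => lambda * psi r
  | None, None => 0
  end.

Definition nps_rate (R : realType) (psi : nat -> R) (lambda : R) (N : nat)
    (A B : {set 'I_N}) : R :=
  if [exists x in A, B == (A :\ x)%SET] then 1
  else if [pick x | (x \notin A) && (B == (x |: A)%SET)] is Some x
  then birth_rate psi lambda (left_dist A x) (right_dist A x)
  else 0.

(* enum A lists the elements of A in increasing order. *)
Definition nu (R : realType) (psi : nat -> R) (N : nat) (A : {set 'I_N}) : R :=
  let s : seq nat := [seq val x | x <- enum A] in
  \prod_(0 <= i < (size s).-1) psi (nth 0 s i.+1 - nth 0 s i)%N.

Definition K (R : realType) (psi : nat -> R) (N : nat) : R :=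
  \sum_(A : {set 'I_N} | A != finset.set0) nu psi A.

Definition pi_init (R : realType) (psi : nat -> R) (N : nat)
    (A : {set 'I_N}) : R :=
  if A == finset.set0 then 0 else nu psi A / K psi N.

(* Main.v *)
Require Import Defs.
From HB Require Import structures.
From mathcomp Require Import all_boot all_order all_algebra.
From mathcomp Require Import all_classical all_reals all_analysis.
From mathcomp Require Import ring lra.

Set Implicit Arguments.
Unset Strict Implicit.
Unset Printing Implicit Defensive.

Import Order.TTheory GRing.Theory Num.Theory.
Import numFieldNormedType.Exports.

Local Open Scope classical_set_scope.
Local Open Scope ring_scope.

(** With [lambda = 1] the chain is reversible with respect to [nu] on the
    non-empty sets, and is killed at rate 1 in each singleton. Starting from [pi],
    the death rate at time [t] is at most the stationary one, [N / K N], and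
    [K N >= N^2 / (2 m)] for a bound [m] on the mean of [psi]; integrating up to
    [t = N / C N] gives the lower bound on the hitting time.

    For the upper bound, let [f_t A] be the probability of survival up to time [t]
    from [A]. The derivative of [sum pi f_t^2] is [-2 D f_t], where [D] is the
    Dirichlet form. Erasing a configuration from left to right defines a flow from
    [pi] to the empty set of energy at most [N^2], so that
    [(sum pi f)^2 <= N^2 * D f] by the Thomson principle. Since [sum pi f_t] is
    non-increasing in [t] and [sum pi f_t^2] drops by at most 1, the mean value
    theorem yields [(sum pi f_t)^2 <= N^2 / (2 t)].

    The weight [x + 1] used for the flow also gives the lower bound on [K N]: the
    excess [x + 1 - sum_k psi k * (x + 1 - k)] lies between 1 and [m]. *)

(** * Detailed balance *)

(** [nu] as a function of an arbitrary list, which allows inductions and splittings; [nuE] holds by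
    conversion. *)
Definition gap_weight (R : realType) (psi : nat -> R) (s : seq nat) : R :=
  \prod_(0 <= i < (size s).-1) psi (nth 0 s i.+1 - nth 0 s i)%N.

Lemma gap_weight1 (R : realType) (psi : nat -> R) (a : nat) :
  gap_weight psi [:: a] = 1.
Proof. by rewrite /gap_weight big_geq. Qed.

Lemma gap_weight_cons2 (R : realType) (psi : nat -> R) (a b : nat) s :
  gap_weight psi (a :: b :: s) = psi (b - a)%N * gap_weight psi (b :: s).
Proof. by rewrite /gap_weight /= big_nat_recl. Qed.

(** The point [a] occurs in both factors, so that the gaps on its two sides are both counted. *)
Lemma gap_weight_cat (R : realType) (psi : nat -> R) (s1 : seq nat) a s2 :
  gap_weight psi (s1 ++ a :: s2) =
  gap_weight psi (rcons s1 a) * gap_weight psi (a :: s2).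
Proof.
elim: s1 => [|c [|e s1] IH] /=; first by rewrite gap_weight1 mul1r.
  by rewrite !gap_weight_cons2 gap_weight1 mulr1.
by rewrite !gap_weight_cons2 -mulrA; congr (_ * _); exact: IH.
Qed.

(** A point put into the gap from [a] to [b] replaces the factor [psi (b - a)] by
    [psi (x - a) * psi (b - x)]; at an end of the list it adds one factor. The quotient is the birth
    rate for [lambda = 1]. On the empty list this fails: the weight stays 1 while the rate is 0. *)
Lemma gap_weight_insert (R : realType) (psi : nat -> R) (s1 s2 : seq nat) x :
  (forall n, (1 <= n)%N -> 0 < psi n) ->
  sorted ltn (s1 ++ x :: s2) -> s1 ++ s2 != [::] ->
  gap_weight psi (s1 ++ x :: s2) = gap_weight psi (s1 ++ s2) *
    birth_rate psi 1 (omap (fun a => x - a)%N (ohead (rev s1)))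
                     (omap (fun b => b - x)%N (ohead s2)).
Proof.
move=> psi_gt0; case/lastP: s1 => [|s1 a]; case: s2 => [|b s2] //= srt _.
- by rewrite gap_weight_cons2 mul1r mulrC.
- by rewrite rev_rcons /= cat_rcons gap_weight_cat cats0 gap_weight_cons2
             gap_weight1 mulr1 mul1r.
- have [ax xb] : (a < x)%N /\ (x < b)%N.
    move: srt; rewrite cat_rcons (sorted_pairwise ltn_trans) pairwise_cat /=.
    by case/and5P => _ _ /andP[-> _] /andP[-> _] _.
  rewrite rev_rcons /= !cat_rcons !(gap_weight_cat psi s1) !gap_weight_cons2.
  have -> : (x - a + (b - x))%N = (b - a)%N.
    by rewrite addnC addnBA 1?ltnW// subnK// ltnW.
  have ba : psi (b - a)%N != 0.
    by rewrite gt_eqF// psi_gt0// subn_gt0 (ltn_trans ax).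
  by field.
Qed.

(** * Configurations as sorted lists of sites *)

Definition sites (N : nat) (A : {set 'I_N}) : seq nat :=
  [seq val x | x <- enum A].

Lemma nuE (R : realType) (psi : nat -> R) N (A : {set 'I_N}) :
  nu psi A = gap_weight psi (sites A).
Proof. by []. Qed.

Lemma mem_sites N (A : {set 'I_N}) (x : 'I_N) : (val x \in sites A) = (x \in A).
Proof. by rewrite /sites mem_map ?mem_enum//; exact: val_inj. Qed.

Lemma sitesP N (A : {set 'I_N}) (k : nat) :
  reflect (exists2 x : 'I_N, x \in A & k = x) (k \in sites A).
Proof.
apply: (iffP mapP) => -[x xA ->]; exists x => //; last by rewrite mem_enum.
by rewrite mem_enum in xA.
Qed.

Lemma sorted_sites N (A : {set 'I_N}) : sorted ltn (sites A).
Proof.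
rewrite /sites /enum_mem -enumT sorted_map.
apply: sorted_filter; first by move=> x y z; exact: ltn_trans.
by rewrite -sorted_map val_enum_ord iota_ltn_sorted.
Qed.

(** Both sides are strictly increasing lists with the same members, hence equal. *)
Lemma sites_setU1 N (A : {set 'I_N}) (x : 'I_N) : x \notin A ->
  sites (x |: A)%SET = [seq k <- sites A | (k < x)%N] ++
                       val x :: [seq k <- sites A | (x < k)%N].
Proof.
move=> xA; apply: (irr_sorted_eq ltn_trans ltnn); first exact: sorted_sites.
  rewrite (sorted_pairwise ltn_trans) pairwise_cat /=.
  rewrite -!(sorted_pairwise ltn_trans) !sorted_filter ?sorted_sites ?andbT//;
    try exact: ltn_trans.
  rewrite filter_all !andbT; apply/allrelP => a b.
  rewrite mem_filter => /andP[ax _]; rewrite inE mem_filter.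
  by case/predU1P => [->//|/andP[xb _]]; exact: ltn_trans xb.
move=> k; rewrite mem_cat inE !mem_filter; apply/sitesP/idP.
  case=> y + ->; rewrite !inE mem_sites => /predU1P[->|->]; first by rewrite eqxx orbT.
  by rewrite !andbT; case: (ltngtP y x).
case/or3P => [/andP[_ /sitesP[y yA ->]]|/eqP ->|/andP[_ /sitesP[y yA ->]]].
- by exists y; rewrite // !inE yA orbT.
- by exists x; rewrite // !inE eqxx.
- by exists y; rewrite // !inE yA orbT.
Qed.

Lemma sites_split N (A : {set 'I_N}) (x : 'I_N) : x \notin A ->
  sites A = [seq k <- sites A | (k < x)%N] ++ [seq k <- sites A | (x < k)%N].
Proof.
move=> xA; apply: (irr_sorted_eq ltn_trans ltnn); first exact: sorted_sites.
  have := sorted_sites (x |: A)%SET; rewrite sites_setU1//.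
  rewrite !(sorted_pairwise ltn_trans) !pairwise_cat /= => /and3P[].
  by rewrite allrel_consr => /andP[_ ->] -> /andP[_ ->].
move=> k; rewrite mem_cat !mem_filter -andb_orl.
apply/idP/andP => [kA|[]//]; split=> //.
case/sitesP: kA => y yA ->; case: ltngtP => // /val_inj yx.
by rewrite -yx yA in xA.
Qed.

(** In the increasing list of sites, the nearest one to the left of [x] is the last one below [x].
    This puts the distances in the form used by [gap_weight_insert]. *)
Lemma left_distE N (A : {set 'I_N}) (x : 'I_N) :
  left_dist A x = omap (fun a => x - a)%N
                    (ohead (rev [seq k <- sites A | (k < x)%N])).
Proof.
rewrite /left_dist; have := mem_filter (fun k => k < x)%N ^~ (sites A).
have : sorted ltn [seq k <- sites A | (k < x)%N].
  by rewrite (sorted_filter ltn_trans)// sorted_sites.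
case/lastP: [seq k <- sites A | _] => [|s a] srt memE; case: pickP => [y|].
- by case/and3P=> yA yx _; have := memE y; rewrite yx mem_sites yA.
- by [].
- case/and3P=> yA yx /forall_inP ymax; rewrite rev_rcons /=.
  have /esym := memE a; rewrite mem_rcons inE eqxx /= => /andP[ax /sitesP[z zA az]].
  have := ymax z zA; rewrite -az ax => /= ay.
  have := memE y; rewrite mem_rcons inE mem_sites yA yx => /predU1P[->//|ys].
  move: srt; rewrite -cats1 (sorted_pairwise ltn_trans) pairwise_cat.
  case/and3P => /allrelP /(_ y a ys); rewrite inE eqxx => /(_ isT) /= ya.
  by rewrite ltnNge ay in ya.
- move=> noy; have /esym := memE a.
  rewrite mem_rcons inE eqxx /= => /andP[ax /sitesP[z zA az]].
  have := noy z; rewrite zA -az ax /= => /negbT/negP[]; apply/forall_inP => t tA.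
  apply/implyP => tx; have := memE t; rewrite mem_rcons inE mem_sites tA tx.
  case/predU1P => [->//|ts]; move: srt.
  rewrite -cats1 (sorted_pairwise ltn_trans) pairwise_cat.
  by case/and3P => /allrelP /(_ t a ts); rewrite inE eqxx => /(_ isT)/ltnW.
Qed.

Lemma right_distE N (A : {set 'I_N}) (x : 'I_N) :
  right_dist A x = omap (fun b => b - x)%N
                    (ohead [seq k <- sites A | (x < k)%N]).
Proof.
rewrite /right_dist; have := mem_filter (fun k => x < k)%N ^~ (sites A).
have : sorted ltn [seq k <- sites A | (x < k)%N].
  by rewrite (sorted_filter ltn_trans)// sorted_sites.
case: [seq k <- sites A | _] => [|b s] srt memE; case: pickP => [y|].
- by case/and3P=> yA yx _; have := memE y; rewrite yx mem_sites yA.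
- by [].
- case/and3P=> yA yx /forall_inP ymin /=.
  have /esym := memE b; rewrite inE eqxx /= => /andP[bx /sitesP[z zA bz]].
  have := ymin z zA; rewrite -bz bx => /= yb.
  have := memE y; rewrite inE mem_sites yA yx => /predU1P[->//|ys].
  move: srt; rewrite (sorted_pairwise ltn_trans) /= => /andP[/allP/(_ y ys)/=].
  by rewrite ltnNge yb.
- move=> noy; have /esym := memE b.
  rewrite inE eqxx /= => /andP[bx /sitesP[z zA bz]].
  have := noy z; rewrite zA -bz bx /= => /negbT/negP[]; apply/forall_inP => t tA.
  apply/implyP => tx; have := memE t; rewrite inE mem_sites tA tx.
  case/predU1P => [->//|ts]; move: srt.
  by rewrite (sorted_pairwise ltn_trans) /= => /andP[/allP/(_ t ts)/ltnW].
Qed.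

(** Detailed balance, since deaths have rate 1. The empty set is excluded: it is absorbing although
    [nu] gives the singletons weight 1. *)
Lemma nu_setU1 (R : realType) (psi : nat -> R) N (A : {set 'I_N}) (x : 'I_N) :
  (forall n, (1 <= n)%N -> 0 < psi n) -> A != finset.set0 -> x \notin A ->
  nu psi (x |: A)%SET =
  nu psi A * birth_rate psi 1 (left_dist A x) (right_dist A x).
Proof.
move=> psi_gt0 A0 xA; rewrite !nuE sites_setU1// gap_weight_insert//.
- by rewrite -sites_split// left_distE right_distE.
- by rewrite -sites_setU1// sorted_sites.
- rewrite -sites_split//; case/set0Pn: A0 => y yA; apply/eqP => s0.
  by have := mem_sites A y; rewrite s0 yA.
Qed.

Lemma nu_set1 (R : realType) (psi : nat -> R) N (x : 'I_N) :
  nu psi [set x]%SET = 1.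
Proof. by rewrite nuE /sites enum_set1 gap_weight1. Qed.

(** The set [B] determines the site at which it differs from [A], so at most one term of the two
    sums is non-zero. *)
Lemma nps_rateE (R : realType) (psi : nat -> R) (lambda : R) N (A B : {set 'I_N}) :
  nps_rate psi lambda A B =
  \sum_(x in A) (B == (A :\ x)%SET)%:R +
  \sum_(x | x \notin A)
     birth_rate psi lambda (left_dist A x) (right_dist A x) *
     (B == (x |: A)%SET)%:R.
Proof.
rewrite /nps_rate; case: ifPn => [/existsP[x /andP[xA /eqP ->]]|noD].
  rewrite (bigD1 x)//= eqxx !big1 ?addr0// => y.
    move=> yA; case: eqP => [/setP/(_ y)|]; last by rewrite mulr0.
    by rewrite !inE eqxx (negPf yA) andbF.
  case/andP => yA yx; case: eqP => // /setP/(_ y).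
  by rewrite !inE eqxx yx yA.
rewrite big1 ?add0r; last first.
  move=> x xA; case: eqP => // BE; case/negP: noD; apply/existsP; exists x.
  by rewrite xA BE eqxx.
case: pickP => [x /andP[xA /eqP ->]|noU].
  rewrite (bigD1 x)//= eqxx mulr1 big1 ?addr0// => y /andP[yA yx].
  case: eqP => [/setP/(_ y)|]; last by rewrite mulr0.
  by rewrite !inE eqxx (negPf yx) (negPf yA).
by rewrite big1// => x xA; have := noU x; rewrite xA /= => ->; rewrite mulr0.
Qed.

Lemma nps_generatorE (R : realType) (psi : nat -> R) (lambda : R) N
    (A : {set 'I_N}) (h : {set 'I_N} -> R) :
  \sum_B nps_rate psi lambda A B * h B =
  \sum_(x in A) h (A :\ x)%SET +
  \sum_(x | x \notin A)
     birth_rate psi lambda (left_dist A x) (right_dist A x) * h (x |: A)%SET.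
Proof.
have sumE (B0 : {set 'I_N}) : \sum_B (B == B0)%:R * h B = h B0.
  rewrite (bigD1 B0)//= eqxx mul1r big1 ?addr0// => B /negPf ->.
  by rewrite mul0r.
under eq_bigr do rewrite nps_rateE mulrDl !mulr_suml.
rewrite big_split /= exchange_big /= [X in _ + X]exchange_big /=.
congr (_ + _); apply: eq_bigr => x _; first exact: sumE.
by under eq_bigr do rewrite -mulrA; rewrite -mulr_sumr sumE.
Qed.

Lemma nps_rate_set0 (R : realType) (psi : nat -> R) (lambda : R) N
    (B : {set 'I_N}) : nps_rate psi lambda finset.set0 B = 0.
Proof.
rewrite nps_rateE big_set0 add0r big1// => x _.
have -> : left_dist finset.set0 x = None.
  by rewrite /left_dist; case: pickP => // y; rewrite inE.
have -> : right_dist finset.set0 x = None.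
  by rewrite /right_dist; case: pickP => // y; rewrite inE.
by rewrite mul0r.
Qed.

(** [nu] of the empty set is an empty product, equal to 1; replaced by 0 it gives the unnormalised
    [pi_init], and sums can run over all sets. *)
Definition nu0 (R : realType) (psi : nat -> R) N (A : {set 'I_N}) : R :=
  if A == finset.set0 then 0 else nu psi A.

Lemma nu0_setU1 (R : realType) (psi : nat -> R) N (A : {set 'I_N}) (x : 'I_N) :
  (forall n, (1 <= n)%N -> 0 < psi n) -> A != finset.set0 -> x \notin A ->
  nu0 psi (x |: A)%SET =
  nu0 psi A * birth_rate psi 1 (left_dist A x) (right_dist A x).
Proof.
move=> psi_gt0 A0 xA; rewrite /nu0 (negPf A0) -nu_setU1//.
by case: eqP => // /setP/(_ x); rewrite !inE eqxx.
Qed.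

Lemma nu_gt0 (R : realType) (psi : nat -> R) N (A : {set 'I_N}) :
  (forall n, (1 <= n)%N -> 0 < psi n) -> 0 < nu psi A.
Proof.
move=> psi_gt0; rewrite nuE; have := sorted_sites A.
elim: (sites A) => [|a [|b s] IH]; first by rewrite /gap_weight big_geq.
  by rewrite gap_weight1.
rewrite gap_weight_cons2 => /= /andP[ab] bs; rewrite mulr_gt0 ?IH//.
by rewrite psi_gt0// subn_gt0.
Qed.

Lemma nu0_ge0 (R : realType) (psi : nat -> R) N (A : {set 'I_N}) :
  (forall n, (1 <= n)%N -> 0 < psi n) -> 0 <= nu0 psi A.
Proof. by move=> psi_gt0; rewrite /nu0; case: ifP => // _; apply/ltW/nu_gt0. Qed.

Lemma sum_setD1 (R : realType) N (x : 'I_N) (P : pred {set 'I_N})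
    (h : {set 'I_N} -> R) :
  \sum_(B : {set 'I_N} | (x \in B) && P (B :\ x)%SET) h B =
  \sum_(A : {set 'I_N} | (x \notin A) && P A) h (x |: A)%SET.
Proof.
rewrite (reindex_onto (fun A => x |: A)%SET (fun B => B :\ x)%SET) /=; last first.
  by move=> B /andP[xB _]; rewrite finset.setD1K.
apply: eq_bigl => A; rewrite finset.setU11 /=; case: (boolP (x \in A)) => xA /=.
  by rewrite andbC; case: eqP => // /setP/(_ x); rewrite !inE eqxx xA.
by rewrite finset.setU1K// eqxx andbT.
Qed.

(** Summation by parts: detailed balance turns the birth term from [A] to [x |: A] into a term of
    the reversed jump. Jumps from singletons to the empty set have no reverse; [g finset.set0 = 0]
    makes the missing terms vanish. *)
Lemma dirichlet_form (R : realType) (psi : nat -> R) N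
    (f g : {set 'I_N} -> R) :
  (forall n, (1 <= n)%N -> 0 < psi n) -> g finset.set0 = 0 ->
  \sum_(A : {set 'I_N}) nu0 psi A * g A * (\sum_B nps_rate psi 1 A B * (f B - f A)) =
  - \sum_(A : {set 'I_N}) \sum_(x in A)
      nu0 psi A * (g A - g (A :\ x)%SET) * (f A - f (A :\ x)%SET).
Proof.
move=> psi_gt0 g0.
under eq_bigr do rewrite (nps_generatorE psi 1 _ (fun B => f B - _)) mulrDr !mulr_sumr.
rewrite big_split /=.
have -> : \sum_(A : {set 'I_N}) \sum_(x | x \notin A) nu0 psi A * g A *
    (birth_rate psi 1 (left_dist A x) (right_dist A x) * (f (x |: A)%SET - f A)) =
  \sum_(A : {set 'I_N}) \sum_(x in A) nu0 psi A * g (A :\ x)%SET * (f A - f (A :\ x)%SET).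
  rewrite (exchange_big_dep xpredT)//= [RHS](exchange_big_dep xpredT)//=.
  apply: eq_bigr => x _.
  under [RHS]eq_bigl do rewrite -[_ \in _]andbT.
  rewrite (sum_setD1 x xpredT); under [RHS]eq_bigl do rewrite andbT.
  apply: eq_bigr => A xA; rewrite finset.setU1K//.
  (* Detailed balance fails at the empty set, but both sides carry the factor [g finset.set0]. *)
  have [->|A0] := eqVneq A finset.set0; first by rewrite g0 !mulr0 !mul0r.
  by rewrite nu0_setU1//; ring.
rewrite -big_split -sumrN; apply: eq_bigr => A _ /=.
rewrite -big_split -sumrN; apply: eq_bigr => x _ /=.
by ring.
Qed.

(** * The flow erasing configurations from the left *)

Definition leftmost N (A : {set 'I_N}) (x : 'I_N) :=
  (x \in A) && [forall y in A, x <= y]%N.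

Lemma leftmost_uniq N (A : {set 'I_N}) (x y : 'I_N) :
  leftmost A x -> leftmost A y -> x = y.
Proof.
case/andP => xA /forall_inP xmin /andP[yA /forall_inP ymin].
by apply/val_inj/eqP; rewrite eqn_leq xmin//= ymin.
Qed.

Lemma leftmost_ex N (A : {set 'I_N}) :
  A != finset.set0 -> exists x, leftmost A x.
Proof.
case/set0Pn => a aA; exists [arg min_(x < a in A) x]%N.
case: arg_minnP => // x xA xmin; rewrite /leftmost xA.
by apply/forall_inP => y /xmin.
Qed.

(** With [leftmost] as a predicate, such a sum has one term for non-empty [A] and none for the empty
    set, which spares a default leftmost site. *)
Lemma sum_leftmost (R : realType) N (A : {set 'I_N}) (x : 'I_N) (h : 'I_N -> R) :
  leftmost A x -> \sum_(y | leftmost A y) h y = h x.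
Proof.
move=> Ax; rewrite (big_pred1 x)// => y.
by apply/idP/eqP => [/leftmost_uniq/(_ Ax)|->].
Qed.

Lemma birth_rate_leftmost (R : realType) (psi : nat -> R) N (A : {set 'I_N})
    (x y : 'I_N) : leftmost A x -> (y < x)%N ->
  birth_rate psi 1 (left_dist A y) (right_dist A y) = psi (x - y)%N.
Proof.
case/andP => xA /forall_inP xmin yx.
have -> : left_dist A y = None.
  rewrite /left_dist; case: pickP => // z /and3P[zA zy _].
  by have := leq_trans zy (ltnW yx); rewrite ltnNge xmin.
rewrite /right_dist; case: pickP => [z /and3P[zA yz /forall_inP zmin]|].
  suff -> : z = x by rewrite /= mul1r.
  apply/val_inj/eqP; rewrite eqn_leq xmin// andbT.
  by have := zmin x xA; rewrite yx.
move/(_ x); rewrite xA yx /= => /negbT/negP[]; apply/forall_inP => z /xmin ->.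
by rewrite implybT.
Qed.

(* The flow through the edge from A to A :\ x, x leftmost, is nu0 A * V x; the
   right-hand side involves its divergence. *)
Lemma leftmost_flow (R : realType) (psi : nat -> R) N (f : {set 'I_N} -> R)
    (V : 'I_N -> R) :
  (forall n, (1 <= n)%N -> 0 < psi n) -> f finset.set0 = 0 ->
  \sum_(A : {set 'I_N}) \sum_(x | leftmost A x) nu0 psi A * V x * (f A - f (A :\ x)%SET) =
  \sum_(A : {set 'I_N}) \sum_(x | leftmost A x) nu0 psi A * f A *
    (V x - \sum_(y : 'I_N | (y < x)%N) psi (x - y)%N * V y).
Proof.
move=> psi_gt0 f0.
(* Reindexing by the set that remains: the flow enters [A] from the sets [y |: A] with [y] to the
   left of [A], and detailed balance gives these the weight [nu0 A * psi (x - y)], where [x] is the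
   leftmost site of [A]. *)
have E : \sum_(A : {set 'I_N}) \sum_(x | leftmost A x) nu0 psi A * V x * f (A :\ x)%SET =
  \sum_(A : {set 'I_N}) \sum_(x | leftmost A x) nu0 psi A * f A *
    (\sum_(y : 'I_N | (y < x)%N) psi (x - y)%N * V y).
  rewrite (exchange_big_dep xpredT)//=.
  transitivity (\sum_(y : 'I_N) \sum_(A : {set 'I_N} | (y \notin A) &&
      [forall z in A, y < z]%N) nu0 psi (y |: A)%SET * V y * f A).
    apply: eq_bigr => y _.
    have := sum_setD1 y (fun A : {set 'I_N} => [forall z in A, y < z]%N)
      (fun A : {set 'I_N} => nu0 psi A * V y * f (A :\ y)%SET).
    under [RHS]eq_bigr => A /andP[yA _] do rewrite finset.setU1K//.
    move=> <-; apply: eq_bigl => A; rewrite /leftmost; congr (_ && _).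
    apply/forall_inP/forall_inP => [yle z|ylt z zA].
      by rewrite !inE => /andP[zy /yle]; rewrite leq_eqVlt eq_sym (inj_eq val_inj) (negPf zy).
    have [->//|zy] := eqVneq z y.
    by rewrite ltnW// ylt// !inE zy.
  rewrite (exchange_big_dep xpredT)//=; apply: eq_bigr => A _.
  have [->|A0] := eqVneq A finset.set0.
    by rewrite f0 !big1// => *; rewrite ?mulr0 ?mul0r.
  have [x Ax] := leftmost_ex A0; rewrite (sum_leftmost _ Ax) mulr_sumr.
  have yE y : (y \notin A) && [forall z in A, y < z]%N = (y < x)%N.
    apply/andP/idP => [[_ /forall_inP]|yx]; first by apply; case/andP: Ax.
    have ylt : [forall z in A, y < z]%N.
      apply/forall_inP => z zA; apply: leq_trans yx _.
      by case/andP: Ax => _ /forall_inP; apply.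
    split=> //; apply/negP => yA.
    by move/forall_inP: ylt => /(_ y yA); rewrite ltnn.
  under eq_bigl do rewrite yE.
  apply: eq_bigr => y yx; have := yE y; rewrite yx => /andP[yA _].
  by rewrite nu0_setU1// (birth_rate_leftmost _ Ax)//; ring.
under eq_bigr do under eq_bigr do rewrite mulrBr.
under eq_bigr do rewrite sumrB.
rewrite sumrB E -sumrB; apply: eq_bigr => A _.
by rewrite -sumrB; apply: eq_bigr => x _; ring.
Qed.

(** * The flow inequality and the partition function *)

(** The substitution [k = x - y] turns the weight [y + 1] into [x + 1 - k]; the shift by one is that
    between ordinals and sites. *)
Lemma convolution_sum (R : realType) (psi : nat -> R) N (x : 'I_N) :
  \sum_(y : 'I_N | (y < x)%N) psi (x - y)%N * y.+1%:R =
  \sum_(1 <= k < x.+1) psi k * (x.+1 - k)%:R.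
Proof.
rewrite big_add1 big_mkord /=.
rewrite -(big_ord_widen N (fun y => psi (x - y)%N * y.+1%:R)) 1?ltnW//.
rewrite (reindex_inj rev_ord_inj) /=; apply: eq_bigr => i _.
by rewrite subKn// subnSK// subSS.
Qed.

(** Each [n + 1 - k] with [k >= 1] is at most [n], and the [psi k] sum to at most 1. *)
Lemma deficit_ge1 (R : realType) (psi : nat -> R) (n : nat) :
  (forall n, (1 <= n)%N -> 0 < psi n) ->
  (forall n, \sum_(1 <= k < n) psi k <= 1) ->
  1 <= n.+1%:R - \sum_(1 <= k < n.+1) psi k * (n.+1 - k)%:R.
Proof.
move=> psi_gt0 psi1; rewrite lerBrDr -lerBrDl -[n.+1%:R]natr1 addrK.
apply: (@le_trans _ _ (\sum_(1 <= k < n.+1) psi k * n%:R)).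
  apply: ler_sum_nat => k /andP[k0 _].
  apply: ler_wpM2l; first exact/ltW/psi_gt0.
  by rewrite ler_nat leq_subLR -add1n leq_add2r.
by rewrite -mulr_suml ler_piMl.
Qed.

(** The sum of [psi k * (n - k)] over all [k >= 1], with real differences, is [n] minus the mean of
    [psi], and dropping its non-positive terms [k >= n] only increases it. The mean is at most the
    second moment, because [k <= k ^ 2]. *)
Lemma deficit_bounded (R : realType) (psi : nat -> R) :
  (forall n, (1 <= n)%N -> 0 < psi n) ->
  (\sum_(1 <= k < n) psi k) @[n --> \oo] --> (1 : R) ->
  cvg ((\sum_(1 <= k < n) k%:R ^+ 2 * psi k) @[n --> \oo]) ->
  exists2 m : R, 0 < m &
    forall n, n%:R - \sum_(1 <= k < n) psi k * (n - k)%:R <= m.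
Proof.
move=> psi_gt0 psi1 psi2.
set S2 := fun n => \sum_(1 <= k < n) k%:R ^+ 2 * psi k.
have S2nd : nondecreasing_seq S2.
  move=> i j ij; rewrite /S2; have [i0|i1] := leqP i 1.
    rewrite big_geq//; rewrite big_nat_cond; apply: sumr_ge0 => k /andP[/andP[k1 _] _].
    by rewrite mulr_ge0// ?exprn_ge0// ltW// psi_gt0.
  rewrite (big_cat_nat (ltnW i1) ij)/= lerDl.
  rewrite big_nat_cond; apply: sumr_ge0 => k /andP[/andP[ik _] _].
  by rewrite mulr_ge0 ?exprn_ge0// ltW// psi_gt0// (leq_trans (ltnW i1)).
set m := limn S2.
have S2m n : S2 n <= m by exact: nondecreasing_cvgn_le.
have m0 : 0 <= m by rewrite (le_trans _ (S2m 0%N))// /S2 big_geq.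
(* [m] is only known to be non-negative; adding 1 makes the constant positive. *)
exists (m + 1); first by rewrite ltr_wpDl.
move=> n; rewrite lerBlDr addrAC -lerBlDl.
suff: n%:R - m <= \sum_(1 <= k < n) psi k * (n - k)%:R.
  by move=> h; lra.
have cv : (n%:R * (\sum_(1 <= k < M) psi k) - m) @[M --> \oo] --> n%:R * 1 - m.
  by apply: cvgB; [apply: cvgMr|exact: cvg_cst].
rewrite -[X in X - m <= _]mulr1.
apply: (cvgr_to_le cv); exists n.+1 => // M /= nM.
have first_moment : \sum_(1 <= k < M) k%:R * psi k <= m.
  apply: le_trans (S2m M); apply: ler_sum_nat => k /andP[k1 _].
  apply: ler_wpM2r; first exact/ltW/psi_gt0.
  by rewrite expr2 ler_peMl// ler1n.
(* The difference is real here and truncated in the goal: terms with [k >= n] are non-positive here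
   and absent there. *)
apply: (@le_trans _ _ (\sum_(1 <= k < M) psi k * (n%:R - k%:R))).
  rewrite mulr_sumr; under [leRHS]eq_bigr do rewrite mulrBr.
  rewrite sumrB lerB//; first by apply: ler_sum => k _; rewrite mulrC.
  by apply: le_trans first_moment; apply: ler_sum => k _; rewrite mulrC.
have [n0|n1] := leqP n 0.
  rewrite [leRHS]big_geq ?(leq_trans n0)//.
  rewrite big_nat_cond; apply: sumr_le0 => k /andP[/andP[k1 _] _].
  apply: mulr_ge0_le0; first exact/ltW/psi_gt0.
  by rewrite subr_le0 ler_nat (leq_trans n0).
rewrite (big_cat_nat n1 (ltnW nM))/= -[leRHS]addr0 lerD//.
  by apply: ler_sum_nat => k /andP[_ kn]; rewrite natrB// ltnW.
rewrite big_nat_cond; apply: sumr_le0 => k /andP[/andP[nk _] _].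
apply: mulr_ge0_le0; last by rewrite subr_le0 ler_nat.
by apply/ltW/psi_gt0; rewrite (leq_trans n1).
Qed.

Lemma KE (R : realType) (psi : nat -> R) N :
  K psi N = \sum_(A : {set 'I_N}) nu0 psi A.
Proof.
by rewrite /K big_mkcond; apply: eq_bigr => A _; rewrite /nu0; case: eqP.
Qed.

Lemma sum_succ_ge (R : realType) N : N%:R ^+ 2 / 2 <= \sum_(x < N) x.+1%:R :> R.
Proof.
elim: N => [|N IH]; first by rewrite big_ord0 expr0n mul0r.
rewrite big_ord_recr /= -[N.+1%:R]natr1.
apply: le_trans (_ : N%:R ^+ 2 / 2 + (N%:R + 1) <= _); last by rewrite lerD2r.
by lra.
Qed.

(** The flow identity for the indicator [f] of the non-empty sets: [f] jumps only on the edges from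
    singletons to the empty set, which sums the weights [x + 1], while the divergence is at most [m]
    at each non-empty set. *)
Lemma K_lower_bound (R : realType) (psi : nat -> R) (m : R) N :
  (forall n, (1 <= n)%N -> 0 < psi n) ->
  (forall n, n%:R - \sum_(1 <= k < n) psi k * (n - k)%:R <= m) ->
  N%:R ^+ 2 / 2 <= m * K psi N.
Proof.
move=> psi_gt0 psim; apply: le_trans (sum_succ_ge R N) _.
pose f (A : {set 'I_N}) : R := (A != finset.set0)%:R.
have f0 : f finset.set0 = 0 by rewrite /f eqxx.
have flow := leftmost_flow (fun x : 'I_N => x.+1%:R) psi_gt0 f0.
apply: (@le_trans _ _ (\sum_(A : {set 'I_N}) \sum_(x | leftmost A x)
    nu0 psi A * x.+1%:R * (f A - f (A :\ x)%SET))).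
  rewrite [leRHS](exchange_big_dep xpredT)//=; apply: ler_sum => x _.
  have lx : leftmost [set x]%SET x.
    rewrite /leftmost finset.set11; apply/forall_inP => y.
    by rewrite inE => /eqP ->.
  (* Only the singleton term is kept; the others are non-negative. *)
  rewrite (bigD1 [set x]%SET lx)/= -[leLHS]addr0 lerD//.
    rewrite /f /nu0 nu_set1 finset.setDv eqxx.
    case: eqP => [/setP/(_ x)|_]; first by rewrite !inE eqxx.
    by rewrite subr0 mul1r mulr1.
  apply: sumr_ge0 => A _; rewrite !mulr_ge0 ?nu0_ge0// subr_ge0 ler_nat.
  have [->|A0] := eqVneq A finset.set0; first by rewrite finset.set0D eqxx.
  by case: (_ != _).
rewrite flow KE mulr_sumr; apply: ler_sum => A _.
have [->|A0] := eqVneq A finset.set0.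
  by rewrite /nu0 eqxx mulr0 big1// => *; rewrite !mul0r.
have [x Ax] := leftmost_ex A0; rewrite (sum_leftmost _ Ax) /f A0 mulr1.
by rewrite convolution_sum mulrC ler_wpM2r// nu0_ge0.
Qed.

Lemma K_gt0 (R : realType) (psi : nat -> R) N :
  (forall n, (1 <= n)%N -> 0 < psi n) -> (1 <= N)%N -> 0 < K psi N.
Proof.
case: N => // N psi_gt0 _; rewrite /K (bigD1 [set ord0]%SET)/=.
  by rewrite ltr_wpDr ?nu_gt0// sumr_ge0// => A _; exact/ltW/nu_gt0.
by apply/set0Pn; exists ord0; rewrite inE.
Qed.

Lemma pi_initE (R : realType) (psi : nat -> R) N (A : {set 'I_N}) :
  pi_init psi A = nu0 psi A / K psi N.
Proof. by rewrite /pi_init /nu0; case: ifP; rewrite // mul0r. Qed.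

Lemma pi_init_ge0 (R : realType) (psi : nat -> R) N (A : {set 'I_N}) :
  (forall n, (1 <= n)%N -> 0 < psi n) -> 0 <= pi_init psi A.
Proof.
move=> psi_gt0; rewrite pi_initE divr_ge0 ?nu0_ge0// KE sumr_ge0// => B _.
exact: nu0_ge0.
Qed.

Lemma pi_init_sum1 (R : realType) (psi : nat -> R) N :
  (forall n, (1 <= n)%N -> 0 < psi n) -> (1 <= N)%N ->
  \sum_(A : {set 'I_N}) pi_init psi A = 1.
Proof.
move=> psi_gt0 N1; under eq_bigr do rewrite pi_initE.
by rewrite -mulr_suml -KE divff// gt_eqF// K_gt0.
Qed.

(** The variance of [z] under [p] is non-negative. *)
Lemma sqr_mean_le (R : realType) (I : finType) (p z : I -> R) :
  (forall i, 0 <= p i) -> \sum_i p i = 1 ->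
  (\sum_i p i * z i) ^+ 2 <= \sum_i p i * z i ^+ 2.
Proof.
have expand m : \sum_i p i * (z i - m) ^+ 2 =
    \sum_i p i * z i ^+ 2 - (2 * m) * \sum_i p i * z i + m ^+ 2 * \sum_i p i.
  rewrite !mulr_sumr -sumrB -big_split /=.
  by apply: eq_bigr => i _; ring.
move=> p0 p1; have : 0 <= \sum_i p i * (z i - \sum_i p i * z i) ^+ 2.
  by apply: sumr_ge0 => i _; rewrite mulr_ge0// sqr_ge0.
by rewrite expand p1 => ?; lra.
Qed.

(** Thomson principle for the leftmost flow with weight [x + 1]. Its divergence is at least 1, so
    the mean of [f] is at most the mean of the weighted increments [z]; the square of the latter is
    bounded by the mean of the squares. *)
Lemma sqr_mean_le_dirichlet (R : realType) (psi : nat -> R) N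
    (f : {set 'I_N} -> R) :
  (forall n, (1 <= n)%N -> 0 < psi n) ->
  (forall n, \sum_(1 <= k < n) psi k <= 1) -> (1 <= N)%N ->
  f finset.set0 = 0 -> (forall A, 0 <= f A) ->
  (\sum_(A : {set 'I_N}) pi_init psi A * f A) ^+ 2 <=
  N%:R ^+ 2 * \sum_(A : {set 'I_N}) \sum_(x in A)
    pi_init psi A * (f A - f (A :\ x)%SET) ^+ 2.
Proof.
move=> psi_gt0 psi1 N1 f0 f_ge0.
have flow := leftmost_flow (fun x : 'I_N => x.+1%:R) psi_gt0 f0.
pose z (A : {set 'I_N}) := \sum_(x | leftmost A x) x.+1%:R * (f A - f (A :\ x)%SET).
have pi_ge0 (A : {set 'I_N}) := @pi_init_ge0 _ _ _ A psi_gt0.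
have le_flow : \sum_(A : {set 'I_N}) pi_init psi A * f A <= \sum_A pi_init psi A * z A.
  have -> : \sum_A pi_init psi A * z A = (K psi N)^-1 *
      \sum_(A : {set 'I_N}) \sum_(x | leftmost A x)
        nu0 psi A * x.+1%:R * (f A - f (A :\ x)%SET).
    rewrite mulr_sumr; apply: eq_bigr => A _; rewrite pi_initE /z !mulr_sumr.
    by apply: eq_bigr => x _; ring.
  rewrite flow mulr_sumr; apply: ler_sum => A _; rewrite pi_initE.
  have [->|A0] := eqVneq A finset.set0.
    by rewrite /nu0 eqxx !mul0r big1 ?mulr0// => *; rewrite !mul0r.
  have [x Ax] := leftmost_ex A0; rewrite (sum_leftmost _ Ax) convolution_sum.
  rewrite [_ / _]mulrC -!mulrA; apply: ler_wpM2l.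
    by rewrite invr_ge0 ltW// K_gt0.
  rewrite ler_wpM2l ?nu0_ge0// ler_peMr// ?f_ge0//.
  exact: deficit_ge1.
have := sqr_mean_le z pi_ge0 (pi_init_sum1 psi_gt0 N1).
have pif_ge0 : 0 <= \sum_(A : {set 'I_N}) pi_init psi A * f A.
  by apply: sumr_ge0 => A _; rewrite mulr_ge0.
move=> jensen; apply: le_trans (le_trans _ jensen) _.
  by rewrite lerXn2r// nnegrE// (le_trans pif_ge0).
rewrite mulr_sumr; apply: ler_sum => A _; rewrite -mulr_sumr [leRHS]mulrCA.
rewrite ler_wpM2l// /z.
have [->|A0] := eqVneq A finset.set0.
  rewrite !big1 ?expr0n ?mulr0// => x; first by rewrite inE.
  by rewrite /leftmost inE.
have [x Ax] := leftmost_ex A0; rewrite (sum_leftmost _ Ax) exprMn.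
have xA : x \in A by case/andP: Ax.
(* Here [x + 1 <= N], as [x] is an ordinal below [N]; the leftmost site then contributes one term of
   the sum over [A]. *)
rewrite ler_pM ?sqr_ge0//; first by rewrite lerXn2r ?nnegrE// ler_nat.
by rewrite (bigD1 x)//= lerDl sumr_ge0// => *; rewrite sqr_ge0.
Qed.

(** * Survival probabilities *)

(** The backward equation holds for positive times only; right-continuity at 0 supplies what the
    mean value theorem needs at the left end when [a = 0]. *)
Lemma MVT_right_continuous (R : realType) (h dh : R -> R) (a b : R) :
  0 <= a -> a < b -> (forall s : R, 0 < s -> is_derive s 1 h (dh s)) ->
  h s @[s --> 0^'+] --> h 0 ->
  exists2 s, a < s < b & h b - h a = dh s * (b - a).
Proof.
move=> a0 ab hd h0.
have cont (s : R) : 0 < s -> h x @[x --> s] --> h s.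
  move=> s0; apply/differentiable_continuous/derivable1_diffP.
  by have [] := hd s s0.
have [||s] := @MVT R h dh a b ab; last by rewrite in_itv /=; exists s.
  by move=> s; rewrite in_itv /= => /andP[as_ _]; apply/hd/(le_lt_trans a0).
have LR : derivable_oo_LRcontinuous h a b; last exact: derivable_oo_LRcontinuous_within LR.
split.
- move=> s; rewrite in_itv /= => /andP[as_ _].
  by have [] := hd s (le_lt_trans a0 as_).
- have [<-//|a_gt0] := eqVneq 0 a.
  by apply: cvg_at_right_filter; apply: cont; rewrite lt_def eq_sym a_gt0.
- by apply: cvg_at_left_filter; apply: cont; exact: le_lt_trans ab.
Qed.

Lemma is_derive_bigsum (R : realType) (I : Type) (r : seq I)
    (h : I -> R -> R) (dh : I -> R) (x v : R) :
  (forall i, is_derive x v (h i) (dh i)) ->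
  is_derive x v (fun t => \sum_(i <- r) h i t) (\sum_(i <- r) dh i).
Proof.
move=> hd; elim: r => [|i r IH].
  under eq_fun do rewrite big_nil.
  by rewrite big_nil; exact: is_derive_cst.
under eq_fun do rewrite big_cons.
by rewrite big_cons; exact: is_deriveD.
Qed.

Lemma cvg_bigsum (R : realType) (I : Type) (r : seq I) (h : I -> R -> R)
    (l : I -> R) (F : set_system R) :
  Filter F -> (forall i, h i t @[t --> F] --> l i) ->
  (\sum_(i <- r) h i t) @[t --> F] --> \sum_(i <- r) l i.
Proof.
move=> FF hl; elim: r => [|i r IH].
  by under eq_fun do rewrite big_nil; rewrite big_nil; exact: cvg_cst.
by under eq_fun do rewrite big_cons; rewrite big_cons; exact: cvgD.
Qed.

(** The backward equation has a vanishing right-hand side in row [a], so [p t a B] keeps its initial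
    value. *)
Lemma absorbing_transition (R : realType) (S : finType) (q : S -> S -> R)
    (p : R -> S -> S -> R) (a B : S) (t : R) :
  is_transition_function q p -> (forall C, q a C = 0) -> 0 <= t ->
  p t a B = (a == B)%:R.
Proof.
move=> [p0 pcvg0 pbackward] qa t0.
have [<-|t_neq0] := eqVneq 0 t; first exact: p0.
have t_gt0 : 0 < t by rewrite lt_def eq_sym t_neq0.
have [s _] := MVT_right_continuous (lexx 0) t_gt0
  (fun s s0 => pbackward s a B s0) (pcvg0 a B).
rewrite big1 ?mul0r; first by move/subr0_eq; rewrite p0.
by move=> C _; rewrite qa mul0r.
Qed.

(** [dirichlet_form] with [g] the indicator of the non-empty sets: for [x] in [A],
    [g A - g (A :\ x)] vanishes unless [A] is the singleton of [x]. Mass is lost through singletons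
    only. *)
Lemma boundary_flux (R : realType) (psi : nat -> R) N (f : {set 'I_N} -> R) :
  (forall n, (1 <= n)%N -> 0 < psi n) -> f finset.set0 = 0 ->
  \sum_(A : {set 'I_N}) nu0 psi A * (\sum_B nps_rate psi 1 A B * (f B - f A)) =
  - \sum_x f [set x]%SET.
Proof.
move=> psi_gt0 f0.
pose g (A : {set 'I_N}) : R := (A != finset.set0)%:R.
have g0 : g finset.set0 = 0 by rewrite /g eqxx.
transitivity (\sum_(A : {set 'I_N}) nu0 psi A * g A *
    (\sum_B nps_rate psi 1 A B * (f B - f A))).
  apply: eq_bigr => A _; rewrite /nu0 /g.
  by case: eqP => _; rewrite ?mul0r// mulr1.
rewrite dirichlet_form//; congr (- _).
rewrite (exchange_big_dep xpredT)//=; apply: eq_bigr => x _.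
have x0 : [set x]%SET != finset.set0 by apply/set0Pn; exists x; rewrite inE.
rewrite (bigD1 [set x]%SET) ?finset.set11//= finset.setDv g0 f0 /nu0 /g x0.
rewrite (negPf x0) nu_set1 !subr0 !mul1r big1 ?addr0// => A /andP[xA Ax].
have -> : A != finset.set0 by apply/set0Pn; exists x.
case: (eqVneq (A :\ x)%SET finset.set0) => [AD|AD]; last by rewrite subrr mulr0 mul0r.
by case/eqP: Ax; rewrite -(finset.setD1K xA) AD finset.setU0.
Qed.

(** [1 - p] obeys the same backward equation as [p], because the generator annihilates constants. *)
Lemma alive_derive (R : realType) (psi : nat -> R) N
    (p : R -> {set 'I_N} -> {set 'I_N} -> R) (t : R) A :
  is_transition_function (@nps_rate R psi 1 N) p -> 0 < t ->
  is_derive t 1 (fun s => 1 - p s A finset.set0)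
    (\sum_B nps_rate psi 1 A B *
      ((1 - p t B finset.set0) - (1 - p t A finset.set0))).
Proof.
move=> [_ _ pbackward] t0.
apply: is_derive_eq.
  by apply: is_deriveB; exact: pbackward.
rewrite sub0r -sumrN; apply: eq_bigr => B _; by ring.
Qed.

(** The probability that the chain started from [pi_init] is non-empty at time [t], as
    [nps_survivalE] shows. *)
Definition survival (R : realType) (psi : nat -> R) N
    (p : R -> {set 'I_N} -> {set 'I_N} -> R) (t : R) : R :=
  \sum_(A : {set 'I_N}) pi_init psi A * (1 - p t A finset.set0).

Lemma alive_set0 (R : realType) (psi : nat -> R) N
    (p : R -> {set 'I_N} -> {set 'I_N} -> R) (t : R) :
  is_transition_function (@nps_rate R psi 1 N) p -> 0 <= t ->
  1 - p t finset.set0 finset.set0 = 0.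
Proof.
move=> ptrans t0; rewrite (absorbing_transition _ ptrans)// ?eqxx ?subrr// => C.
exact: nps_rate_set0.
Qed.

Lemma survival0 (R : realType) (psi : nat -> R) N
    (p : R -> {set 'I_N} -> {set 'I_N} -> R) :
  (forall n, (1 <= n)%N -> 0 < psi n) -> (1 <= N)%N ->
  is_transition_function (@nps_rate R psi 1 N) p -> survival psi p 0 = 1.
Proof.
move=> psi_gt0 N1 ptrans; rewrite -(pi_init_sum1 psi_gt0 N1) /survival.
apply: eq_bigr => A _; rewrite (transition_at0 ptrans) /pi_init.
by case: eqP => _; rewrite ?mul0r// subr0 mulr1.
Qed.

Lemma survival_derive (R : realType) (psi : nat -> R) N
    (p : R -> {set 'I_N} -> {set 'I_N} -> R) (t : R) :
  (forall n, (1 <= n)%N -> 0 < psi n) ->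
  is_transition_function (@nps_rate R psi 1 N) p -> 0 < t ->
  is_derive t 1 (survival psi p)
    (- ((\sum_(x : 'I_N) (1 - p t [set x]%SET finset.set0)) / K psi N)).
Proof.
move=> psi_gt0 ptrans t0; rewrite /survival.
apply: is_derive_eq.
  apply: is_derive_bigsum => A; apply: is_deriveZ.
  exact: (@alive_derive _ psi N p t A).
rewrite -mulNr -(@boundary_flux R psi N (fun A => 1 - p t A finset.set0) psi_gt0).
  rewrite mulr_suml; apply: eq_bigr => A _.
  by rewrite pi_initE /GRing.scale /=; ring.
by rewrite (alive_set0 ptrans)// ltW.
Qed.

Lemma survival_cvg0 (R : realType) (psi : nat -> R) N
    (p : R -> {set 'I_N} -> {set 'I_N} -> R) :
  is_transition_function (@nps_rate R psi 1 N) p ->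
  survival psi p t @[t --> 0^'+] --> survival psi p 0.
Proof.
move=> ptrans; apply: cvg_bigsum => A; apply: cvgMr.
by apply: cvgB; [exact: cvg_cst|exact: transition_cvg0 ptrans _ _].
Qed.

Lemma survival_lower_bound (R : realType) (psi : nat -> R) N
    (p : R -> {set 'I_N} -> {set 'I_N} -> R) (t : R) :
  (forall n, (1 <= n)%N -> 0 < psi n) -> (1 <= N)%N ->
  is_transition_function (@nps_rate R psi 1 N) p ->
  (forall s A, 0 <= s -> 0 <= p s A finset.set0 <= 1) -> 0 < t ->
  1 - survival psi p t <= N%:R / K psi N * t.
Proof.
move=> psi_gt0 N1 ptrans p01 t0.
have [s /andP[s0 _]] := MVT_right_continuous (lexx 0) t0
  (fun s => @survival_derive _ _ _ _ s psi_gt0 ptrans) (survival_cvg0 ptrans).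
rewrite survival0// subr0 => /eqP; rewrite subr_eq => /eqP ->.
rewrite opprD addrCA subrr addr0 mulNr opprK ler_pM2r// ler_pM2r ?invr_gt0 ?K_gt0//.
(* There are [N] singletons, and survival from each has probability at most 1. *)
apply: (@le_trans _ _ (\sum_(x : 'I_N) 1)); last by rewrite sumr_const card_ord.
apply: ler_sum => x _; have /andP[p0 _] := p01 s [set x]%SET (ltW s0).
by rewrite lerBlDr lerDl.
Qed.

Lemma survival_nincr (R : realType) (psi : nat -> R) N
    (p : R -> {set 'I_N} -> {set 'I_N} -> R) (s t : R) :
  (forall n, (1 <= n)%N -> 0 < psi n) -> (1 <= N)%N ->
  is_transition_function (@nps_rate R psi 1 N) p ->
  (forall s A, 0 <= s -> 0 <= p s A finset.set0 <= 1) -> 0 <= s -> s < t ->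
  survival psi p t <= survival psi p s.
Proof.
move=> psi_gt0 N1 ptrans p01 s0 st.
have [u /andP[su _]] := MVT_right_continuous s0 st
  (fun u => @survival_derive _ _ _ _ u psi_gt0 ptrans) (survival_cvg0 ptrans).
move=> E; rewrite -subr_le0 E; apply: mulr_le0_ge0; last by rewrite subr_ge0 ltW.
rewrite oppr_le0; apply: divr_ge0; last exact/ltW/K_gt0.
apply: sumr_ge0 => x _; rewrite subr_ge0.
by have /andP[] := p01 u [set x]%SET (le_trans s0 (ltW su)).
Qed.

(** The squared norm, in the space of square-integrable functions for [pi_init], of the survival
    probability as a function of the starting set. *)
Definition survival2 (R : realType) (psi : nat -> R) N
    (p : R -> {set 'I_N} -> {set 'I_N} -> R) (t : R) : R :=
  \sum_(A : {set 'I_N}) pi_init psi A * (1 - p t A finset.set0) ^+ 2.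

(** [dirichlet_form] with [f] and [g] both equal to the survival probability; the factor 2 comes
    from differentiating the square. *)
Lemma survival2_derive (R : realType) (psi : nat -> R) N
    (p : R -> {set 'I_N} -> {set 'I_N} -> R) (t : R) :
  (forall n, (1 <= n)%N -> 0 < psi n) ->
  is_transition_function (@nps_rate R psi 1 N) p -> 0 < t ->
  is_derive t 1 (survival2 psi p)
    (- (2 * \sum_(A : {set 'I_N}) \sum_(x in A) pi_init psi A *
      ((1 - p t A finset.set0) - (1 - p t (A :\ x)%SET finset.set0)) ^+ 2)).
Proof.
move=> psi_gt0 ptrans t0; rewrite /survival2.
apply: is_derive_eq.
  apply: is_derive_bigsum => A; apply: is_deriveZ.
  by apply: is_deriveM; exact: (@alive_derive _ psi N p t A).
pose f (A : {set 'I_N}) := 1 - p t A finset.set0.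
have f0 : f finset.set0 = 0 by apply: (alive_set0 ptrans); exact: ltW.
transitivity (2 / K psi N * \sum_(A : {set 'I_N})
    nu0 psi A * f A * (\sum_B nps_rate psi 1 A B * (f B - f A))).
  rewrite mulr_sumr; apply: eq_bigr => A _.
  by rewrite pi_initE /GRing.scale /= -/(f A); ring.
rewrite dirichlet_form// mulrN; congr (- _); rewrite -mulrA; congr (_ * _).
rewrite mulr_sumr; apply: eq_bigr => A _; rewrite mulr_sumr.
by apply: eq_bigr => x _; rewrite pi_initE /f; ring.
Qed.

Lemma survival_upper_bound (R : realType) (psi : nat -> R) N
    (p : R -> {set 'I_N} -> {set 'I_N} -> R) (t : R) :
  (forall n, (1 <= n)%N -> 0 < psi n) ->
  (forall n, \sum_(1 <= k < n) psi k <= 1) -> (1 <= N)%N ->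
  is_transition_function (@nps_rate R psi 1 N) p ->
  (forall s A, 0 <= s -> 0 <= p s A finset.set0 <= 1) -> 0 < t ->
  survival psi p t ^+ 2 <= N%:R ^+ 2 / (2 * t).
Proof.
move=> psi_gt0 psi1 N1 ptrans p01 t0.
have cvg0 : survival2 psi p s @[s --> 0^'+] --> survival2 psi p 0.
  apply: cvg_bigsum => A; apply: cvgMr.
  have cvA : 1 - p s A finset.set0 @[s --> 0^'+] --> 1 - p 0 A finset.set0.
    by apply: cvgB; [exact: cvg_cst|exact: transition_cvg0 ptrans _ _].
  exact: cvgM.
have [s /andP[s0 st]] := MVT_right_continuous (lexx 0) t0
  (fun s => @survival2_derive _ _ _ _ s psi_gt0 ptrans) cvg0.
rewrite subr0; set D := \sum_(A : {set 'I_N}) _ => E.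
have S0 : survival2 psi p 0 = 1.
  rewrite -(pi_init_sum1 psi_gt0 N1); apply: eq_bigr => A _.
  rewrite (transition_at0 ptrans) /pi_init.
  by case: eqP => _; rewrite ?mul0r// subr0 expr1n mulr1.
have St : 0 <= survival2 psi p t.
  by apply: sumr_ge0 => A _; rewrite mulr_ge0 ?pi_init_ge0 ?sqr_ge0.
(* [survival2] starts at 1 and stays non-negative, so its mean rate of decrease [2 * D] over the
   time [t] is at most [1 / t]. *)
have Dt : D <= (2 * t)^-1.
  rewrite -[leRHS]div1r ler_pdivlMr ?mulr_gt0//.
  rewrite S0 in E; move: D St E => D St E.
  by lra.
have surv_ge0 u : 0 <= u -> 0 <= survival psi p u.
  move=> u0; apply: sumr_ge0 => A _; rewrite mulr_ge0 ?pi_init_ge0// subr_ge0.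
  by have /andP[] := p01 u A u0.
(* The bound on [D] holds at the intermediate time [s] only; monotonicity of [survival] carries the
   estimate to [t]. *)
apply: (@le_trans _ _ (survival psi p s ^+ 2)).
  rewrite lerXn2r ?nnegrE ?surv_ge0 ?(ltW t0) ?(ltW s0)//.
  exact: survival_nincr (ltW s0) st.
apply: le_trans (_ : N%:R ^+ 2 * D <= _).
  apply: (sqr_mean_le_dirichlet psi_gt0 psi1 N1 (f := fun A => 1 - p s A finset.set0)).
    by apply: (alive_set0 ptrans); exact: ltW.
  by move=> A; rewrite subr_ge0; have /andP[] := p01 s A (ltW s0).
by rewrite ler_wpM2l// sqr_ge0.
Qed.

(** * The hitting time *)

Lemma rat_sequence_dense (R : realType) : exists r : nat -> R,
  forall x y, x < y -> exists n, x < r n < y.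
Proof.
(* Naturals that code no rational get the value 0, which is harmless. *)
exists (fun n => ratr (odflt 0 (unpickle n))) => x y xy.
have [q] := rat_in_itvoo xy; rewrite in_itv /= => xqy.
by exists (pickle q); rewrite pickleK.
Qed.

(** After a hit at [s < t], right-continuity keeps the path at [a] on a short interval to the right
    of [s], which contains one of the times [r n] below [t]. The event thus depends on countably
    many times. *)
Lemma hitting_time_ltP (R : realType) (S T : Type) (X : R -> T -> S) (a : S)
    (r : nat -> R) (w : T) (t : R) :
  (forall x y, x < y -> exists n, x < r n < y) ->
  (forall s, 0 <= s -> \forall u \near s^'+, X u w = X s w) ->
  (hitting_time X a w < t%:E)%E <->
  exists n, [/\ 0 <= r n, r n < t & X (r n) w = a].
Proof.
move=> r_dense rcont; split=> [|[n [rn0 rnt Xa]]]; last first.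
  apply: (@le_lt_trans _ _ (r n)%:E); last by rewrite lte_fin.
  by apply: ereal_inf_lbound; exists (r n).
move/ereal_inf_lt => [_ [s [s0 Xsa] <-]]; rewrite lte_fin => st.
have [e /= e0 He] := rcont s s0.
have [n /andP[sr rt]] : exists n, s < r n < Num.min t (s + e).
  by apply: r_dense; rewrite lt_min st ltrDl.
move: rt; rewrite lt_min => /andP[rt re].
exists n; split=> //; first exact/ltW/(le_lt_trans s0).
rewrite -Xsa; apply: He => //=.
by rewrite distrC ger0_norm ?subr_ge0 1?ltW// ltrBlDl.
Qed.

Lemma hitting_time_leP (R : realType) (S T : Type) (X : R -> T -> S) (a : S)
    (w : T) (t : R) :
  (hitting_time X a w <= t%:E)%E <->
  forall n, (hitting_time X a w < (t + n.+1%:R^-1)%:E)%E.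
Proof.
split=> [h n|h]; first by rewrite (le_lt_trans h)// lte_fin ltrDl invr_gt0.
apply/lee_addgt0Pr => e e0.
have [n _ /(_ n (leqnn n)) /= ne] := near_infty_natSinv_lt (PosNum e0).
by rewrite ltW// (lt_le_trans (h n))// -EFinD lee_fin lerD2l ltW.
Qed.

Lemma measurable_hitting_time_lt (R : realType) (S : finType)
    (d : measure_display) (T : measurableType d) (X : R -> T -> S) (a : S)
    (t : R) :
  (forall (s : R) A, 0 <= s -> measurable [set w | X s w = A]) ->
  (forall w (s : R), 0 <= s -> \forall u \near s^'+, X u w = X s w) ->
  measurable [set w | (hitting_time X a w < t%:E)%E].
Proof.
move=> mX rcont; have [r r_dense] := rat_sequence_dense R.
have -> : [set w | (hitting_time X a w < t%:E)%E] = \bigcup_n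
    (if (0 <= r n) && (r n < t) then [set w | X (r n) w = a] else set0).
  apply/seteqP; split=> w /=.
    move/(hitting_time_ltP a t r_dense (rcont w)) => [n [r0 rt Xa]].
    by exists n => //; rewrite r0 rt.
  move=> [n _]; case: ifP => // /andP[r0 rt] Xa.
  by apply/(hitting_time_ltP a t r_dense (rcont w)); exists n.
apply: bigcup_measurable => n _; case: ifP => // /andP[r0 _].
exact: mX.
Qed.

Lemma measurable_hitting_time_itv (R : realType) (S : finType)
    (d : measure_display) (T : measurableType d) (X : R -> T -> S) (a : S)
    (t u : R) :
  (forall (s : R) A, 0 <= s -> measurable [set w | X s w = A]) ->
  (forall w (s : R), 0 <= s -> \forall u \near s^'+, X u w = X s w) ->
  measurable [set w | (t%:E <= hitting_time X a w <= u%:E)%E].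
Proof.
move=> mX rcont.
have -> : [set w | (t%:E <= hitting_time X a w <= u%:E)%E] =
    ~` [set w | (hitting_time X a w < t%:E)%E] `&`
    \bigcap_n [set w | (hitting_time X a w < (u + n.+1%:R^-1)%:E)%E].
  apply/seteqP; split=> w /=.
    case/andP=> tw wu; split; first by apply/negP; rewrite -leNgt.
    by move=> n _; apply: (hitting_time_leP X a w u).1.
  case=> /negP; rewrite -leNgt => -> h /=.
  by apply/hitting_time_leP => n; exact: h.
apply: measurableI; first exact/measurableC/measurable_hitting_time_lt.
by apply: bigcap_measurable => [|n _]; [exists 0%N|exact: measurable_hitting_time_lt].
Qed.

(** * Finite-dimensional distributions and absorption *)

Lemma probability_finite_partition (R : realType) (S : finType)
    (d : measure_display) (T : measurableType d) (P : probability T R)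
    (Y : T -> S) (E : set T) :
  (forall A, measurable [set w | Y w = A]) -> measurable E ->
  P E = (\sum_A P (E `&` [set w | Y w = A]))%E.
Proof.
move=> mY mE.
have -> : P E = P (\bigcup_(A in [set: S]) (E `&` [set w | Y w = A])).
  congr (P _); apply/seteqP; split=> w; first by move=> Ew; exists (Y w).
  by case=> A _ [].
rewrite measure_fin_bigcup//.
- have -> : [set: S] = [set` enum S].
    by apply/seteqP; split=> A //= _; rewrite mem_enum.
  by rewrite -fsbig_seq ?enum_uniq// big_enum.
- exact: finite_finset.
- by move=> A B _ _ [w [[_ <-] [_ <-]]].
- by move=> A _; exact: measurableI.
Qed.

Lemma chain_fdd2 (R : realType) (S : finType) (mu : S -> R)
    (p : R -> S -> S -> R) (d : measure_display) (T : measurableType d)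
    (P : probability T R) (X : R -> T -> S) (t : R) (A B : S) :
  (forall (n : nat) (t : nat -> R) (A : nat -> S),
      t 0%N = 0 -> (forall i j, (i <= j)%N -> t i <= t j) ->
      P [set w | forall i, (i <= n)%N -> X (t i) w = A i] =
      (mu (A 0%N) *
       \prod_(0 <= i < n) p (t i.+1 - t i) (A i) (A i.+1))%:E) ->
  0 <= t ->
  P [set w | X 0 w = A /\ X t w = B] = (mu A * p t A B)%:E.
Proof.
move=> fdd t0.
have := fdd 1%N (fun i => if i is 0%N then 0 else t)
  (fun i => if i is 0%N then A else B) erefl.
rewrite big_nat1 subr0 => <-; last by move=> [|i] [|j].
congr (P _); apply/seteqP; split=> w /=; first by case=> XA XB [|[|i]].
by move=> h; split; [exact: (h 0%N)|exact: (h 1%N)].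
Qed.

Lemma chain_fdd3 (R : realType) (S : finType) (mu : S -> R)
    (p : R -> S -> S -> R) (d : measure_display) (T : measurableType d)
    (P : probability T R) (X : R -> T -> S) (s t : R) (A B D : S) :
  (forall (n : nat) (t : nat -> R) (A : nat -> S),
      t 0%N = 0 -> (forall i j, (i <= j)%N -> t i <= t j) ->
      P [set w | forall i, (i <= n)%N -> X (t i) w = A i] =
      (mu (A 0%N) *
       \prod_(0 <= i < n) p (t i.+1 - t i) (A i) (A i.+1))%:E) ->
  0 <= s -> s <= t ->
  P [set w | [/\ X 0 w = A, X s w = B & X t w = D]] =
  (mu A * (p s A B * p (t - s) B D))%:E.
Proof.
move=> fdd s0 st; have t0 := le_trans s0 st.
have := fdd 2%N (fun i => match i with 0%N => 0 | 1%N => s | _ => t end)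
  (fun i => match i with 0%N => A | 1%N => B | _ => D end) erefl.
rewrite big_nat_recl// big_nat1 subr0 => <-; last by move=> [|[|i]] [|[|j]].
congr (P _); apply/seteqP; split=> w /=; first by case=> XA XB XD [|[|[|i]]].
by move=> h; split; [exact: (h 0%N)|exact: (h 1%N)|exact: (h 2%N)].
Qed.

(** Splitting by the values at times 0 and [t] leaves three-time probabilities, each with a factor
    [p (t - s) a B], which is 0 for [B] other than [a]. *)
Lemma chain_absorbed (R : realType) (S : finType) (q : S -> S -> R)
    (mu : S -> R) (d : measure_display) (T : measurableType d)
    (P : probability T R) (X : R -> T -> S) (a : S) (s t : R) :
  is_markov_chain q mu P X -> (forall C, q a C = 0) -> 0 <= s -> s <= t ->
  P ([set w | X s w = a] `&` ~` [set w | X t w = a]) = 0%E.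
Proof.
move=> [mX _ [p ptrans fdd]] qa s0 st.
have mE : measurable ([set w | X s w = a] `&` ~` [set w | X t w = a]).
  by apply: measurableI; [exact: mX|apply/measurableC/mX; exact: le_trans st].
rewrite (probability_finite_partition P (Y := X 0))//; last by move=> A; exact: mX.
apply: big1 => A _.
rewrite (probability_finite_partition P (Y := X t)); last 2 first.
- by move=> B; apply: mX; exact: le_trans st.
- by apply: measurableI => //; exact: mX.
apply: big1 => B _; have [->|Ba] := eqVneq B a.
  by rewrite (_ : _ `&` _ = set0) ?measure0// -subset0 => w [[[]]].
have -> : [set w | X s w = a] `&` ~` [set w | X t w = a] `&`
    [set w | X 0 w = A] `&` [set w | X t w = B] =
    [set w | [/\ X 0 w = A, X s w = a & X t w = B]].
  apply/seteqP; split=> w /=; first by case=> [[[]]].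
  by case=> XA Xs Xt; repeat split=> //; rewrite Xt; exact/eqP.
rewrite (chain_fdd3 _ _ _ fdd)// (@absorbing_transition _ _ _ _ a B _ ptrans)// ?subr_ge0//.
by rewrite [a == B]eq_sym (negPf Ba) !mulr0.
Qed.

(** Absorption is known in law only, so single paths may leave [a]. The event is covered by the null
    events of being in [a] at time [r n] and not at time [t], for the countably many [r n] in
    question. *)
Lemma hitting_time_lt_null (R : realType) (S : finType) (q : S -> S -> R)
    (mu : S -> R) (d : measure_display) (T : measurableType d)
    (P : probability T R) (X : R -> T -> S) (a : S) (t : R) :
  is_markov_chain q mu P X -> (forall C, q a C = 0) -> 0 <= t ->
  P ([set w | (hitting_time X a w < t%:E)%E] `&` ~` [set w | X t w = a]) = 0%E.
Proof.
move=> chain qa t0; have [mX rcont _] := chain.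
have [r r_dense] := rat_sequence_dense R.
have mE : measurable
    ([set w | (hitting_time X a w < t%:E)%E] `&` ~` [set w | X t w = a]).
  by apply: measurableI; [exact: measurable_hitting_time_lt|exact/measurableC/mX].
apply/(negligibleP P mE).
apply: (@negligibleS _ _ _ _ (\bigcup_n (if (0 <= r n) && (r n < t) then
    [set w | X (r n) w = a] `&` ~` [set w | X t w = a] else set0))).
  move=> w /= [/(hitting_time_ltP a t r_dense (rcont w))[n [r0 rt Xa]] Xt].
  by exists n => //; rewrite r0 rt.
apply: negligible_bigcup => n; case: ifP => [/andP[r0 rt]|_]; last exact: negligible_set0.
apply/negligibleP.
  by apply: measurableI; [exact: mX|exact/measurableC/mX].
exact: (chain_absorbed chain qa r0 (ltW rt)).
Qed.

(** A hit before [t] forces [X t w = a] up to a null set, and a hitting time above [u] excludes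
    [X u w = a]. *)
Lemma hitting_time_itv_probability (R : realType) (S : finType)
    (q : S -> S -> R) (mu : S -> R) (d : measure_display)
    (T : measurableType d) (P : probability T R) (X : R -> T -> S) (a : S)
    (t u : R) :
  is_markov_chain q mu P X -> (forall C, q a C = 0) -> 0 <= t -> 0 <= u ->
  (1 - (P [set w | X t w = a] + P (~` [set w | X u w = a])) <=
   P [set w | t%:E <= hitting_time X a w <= u%:E])%E.
Proof.
move=> chain qa t0 u0; have [mX rcont _] := chain.
have mE := measurable_hitting_time_itv a t u mX rcont.
have mlt := measurable_hitting_time_lt a t mX rcont.
set E := [set w | _] in mE *.
have mt : measurable [set w | X t w = a] by exact: mX.
have mu' : measurable [set w | X u w = a] by exact: mX.
have -> : P E = (1 - P (~` E))%E by rewrite -probability_setC ?setCK//; exact: measurableC.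
rewrite leeB//.
pose Z := [set w | (hitting_time X a w < t%:E)%E] `&` ~` [set w | X t w = a].
have mZ : measurable Z by apply: measurableI => //; exact: measurableC.
apply: (@le_trans _ _ (P (([set w | X t w = a] `|` Z) `|` ~` [set w | X u w = a]))).
  apply: le_measure; rewrite ?inE.
  - exact: measurableC.
  - by apply: measurableU; [exact: measurableU|exact: measurableC].
  - move=> w /=; rewrite /E /= => /negP; rewrite negb_and -!ltNge => /orP[wt|wu].
      left; have [Xt|Xt] := pselect (X t w = a); first by left.
      by right.
    right => Xu; move: wu; rewrite ltNge => /negP; apply.
    by apply: ereal_inf_lbound; exists u.
apply: le_trans (measureU2 _ _ _) _; [exact: measurableU|exact: measurableC|].
have Z0 : P Z = 0%E by exact: hitting_time_lt_null chain qa t0.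
have UE : P ([set w | X t w = a] `|` Z) = P [set w | X t w = a].
  exact: measureU0 mt mZ Z0.
by apply: leeD => //; rewrite -UE.
Qed.

(** The bounds on [p] are read off from the chain: [pi_init psi A * p s A finset.set0] is the
    probability of an event contained in one of probability [pi_init psi A], which is positive for
    non-empty [A]. The empty set is covered by absorption. *)
Lemma nps_survivalE (R : realType) (psi : nat -> R) N (d : measure_display)
    (T : measurableType d) (P : probability T R) (X : R -> T -> {set 'I_N}) :
  (forall n, (1 <= n)%N -> 0 < psi n) -> (1 <= N)%N ->
  is_markov_chain (@nps_rate R psi 1 N) (@pi_init R psi N) P X ->
  exists p : R -> {set 'I_N} -> {set 'I_N} -> R,
    [/\ is_transition_function (@nps_rate R psi 1 N) p,
        (forall s A, 0 <= s -> 0 <= p s A finset.set0 <= 1) &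
        (forall t, 0 <= t ->
          P [set w | X t w = finset.set0] = (1 - survival psi p t)%:E)].
Proof.
move=> psi_gt0 N1 [mX _ [p ptrans fdd]]; exists p; split=> //.
- move=> s A s0.
  have mXs := mX s finset.set0 s0.
  have mX0 := mX 0 A (lexx 0).
  have fdd0 : P [set w | X 0 w = A] = (pi_init psi A)%:E.
    have pi1 : pi_init psi A * p 0 A A = pi_init psi A.
      by rewrite (transition_at0 ptrans) eqxx mulr1.
    have := chain_fdd2 A A fdd (lexx 0); rewrite pi1 => <-.
    by congr (P _); apply/seteqP; split=> w //= -[].
  have [->|A0] := eqVneq A finset.set0.
    rewrite (absorbing_transition _ ptrans)// ?eqxx ?ler01 ?lexx// => C.
    exact: nps_rate_set0.
  have pi_gt0 : 0 < pi_init psi A.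
    by rewrite /pi_init (negPf A0) divr_gt0 ?nu_gt0 ?K_gt0.
  have fdds := chain_fdd2 A finset.set0 fdd s0.
  rewrite -(pmulr_rge0 _ pi_gt0) -(ger_pMr _ pi_gt0).
  rewrite -!lee_fin -fdds -fdd0.
  rewrite measure_ge0/=; apply: le_measure; rewrite ?inE//; last by move=> w [].
  exact: measurableI.
- move=> t t0; rewrite (probability_finite_partition P (Y := X 0)); last 2 first.
  + by move=> A; exact: mX.
  + exact: mX.
  transitivity (\sum_(A : {set 'I_N}) (pi_init psi A * p t A finset.set0)%:E)%E.
    apply: eq_bigr => A _; rewrite -(chain_fdd2 A finset.set0 fdd t0).
    by rewrite setIC.
  rewrite sumEFin -(pi_init_sum1 psi_gt0 N1) /survival -sumrB; congr EFin.
  by apply: eq_bigr => A _; ring.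
Qed.

(** At time [N / c] the probability of extinction is at most [N / K N * (N / c)], hence at most
    [2 * m / c] by the bound on [K]. At time [c * N ^ 2] the squared survival probability is at most
    [1 / (2 * c)], whence the square root. *)
Lemma hitting_time_estimate (R : realType) (psi : nat -> R) (m c : R) N
    (d : measure_display) (T : measurableType d) (P : probability T R)
    (X : R -> T -> {set 'I_N}) :
  (forall n, (1 <= n)%N -> 0 < psi n) ->
  (forall n, \sum_(1 <= k < n) psi k <= 1) ->
  (forall n, n%:R - \sum_(1 <= k < n) psi k * (n - k)%:R <= m) ->
  (1 <= N)%N -> 0 < c ->
  is_markov_chain (@nps_rate R psi 1 N) (@pi_init R psi N) P X ->
  ((1 - (2 * m * c^-1 + Num.sqrt (2^-1 * c^-1)))%:E <=
   P [set w | (N%:R / c)%:E <= hitting_time X finset.set0 w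
                            <= (c * N%:R ^+ 2)%:E])%E.
Proof.
move=> psi_gt0 psi1 psim N1 c0 chain.
have N0 : 0 < N%:R :> R by rewrite ltr0n.
have [p [ptrans p01 survE]] := nps_survivalE psi_gt0 N1 chain.
have t0 : 0 < N%:R / c by rewrite divr_gt0.
have u0 : 0 < c * N%:R ^+ 2 by rewrite mulr_gt0// exprn_gt0.
have := hitting_time_itv_probability chain (@nps_rate_set0 _ psi 1 N) (ltW t0) (ltW u0).
apply: le_trans; have [mX _ _] := chain.
rewrite probability_setC; last exact/mX/ltW.
rewrite !survE ?(ltW t0) ?(ltW u0)// -!EFinB lee_fin lerD2l lerN2 lerD//.
  apply: le_trans (survival_lower_bound psi_gt0 N1 ptrans p01 t0) _.
  rewrite mulrA ler_pM2r ?invr_gt0// mulrAC ler_pdivrMr ?K_gt0//.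
  by have := K_lower_bound N psi_gt0 psim; lra.
rewrite opprB addrC subrK.
have := survival_upper_bound psi_gt0 psi1 N1 ptrans p01 u0.
have -> : N%:R ^+ 2 / (2 * (c * N%:R ^+ 2)) = 2^-1 * c^-1 :> R.
  by field; rewrite !gt_eqF.
move=> /ler_wsqrtr; rewrite sqrtr_sqr; apply: le_trans; exact: ler_norm.
Qed.

(** * Passage to the limit *)

Theorem theorem1p3 (R : realType) (psi : nat -> R)
  (psi_gt0 : forall n, (1 <= n)%N -> 0 < psi n)
  (psi_sum1 : (\sum_(1 <= k < n) psi k) @[n --> \oo] --> (1 : R))
  (psi_ratio_decr : forall n, (1 <= n)%N ->
     psi n.+1 / psi n.+2 <= psi n / psi n.+1)
  (psi_ratio_cvg1 : psi n / psi n.+1 @[n --> \oo] --> (1 : R))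
  (psi_moment2 : cvg ((\sum_(1 <= k < n) k%:R ^+ 2 * psi k) @[n --> \oo]))
  (d : nat -> measure_display) (T : forall N, measurableType (d N))
  (P : forall N, probability (T N) R)
  (X : forall N, R -> T N -> {set 'I_N})
  (X_nps : forall N, (1 <= N)%N ->
     is_markov_chain (@nps_rate R psi 1 N) (@pi_init R psi N) (P N) (X N))
  (C : nat -> R)
  (C_incr : forall m n, (1 <= m)%N -> (m <= n)%N -> C m <= C n)
  (C_cvg : C n @[n --> \oo] --> +oo) :
  P N [set w | ((N%:R / C N)%:E <= hitting_time (X N) finset.set0 w
                 <= (C N * N%:R ^+ 2)%:E)%E]
    @[N --> \oo] --> 1%E.
Proof.
(* The partial sums are non-decreasing with limit 1. *)
have psi1 n : \sum_(1 <= k < n) psi k <= 1.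
  apply: (cvgr_to_ge psi_sum1); exists n.+1 => // M /= nM.
  have [n1|n1] := leqP n 1.
    rewrite big_geq//; rewrite big_nat_cond sumr_ge0// => k /andP[/andP[k1 _] _].
    exact/ltW/psi_gt0.
  rewrite (big_cat_nat (ltnW n1) (ltnW nM))/= lerDl big_nat_cond.
  apply: sumr_ge0 => k /andP[/andP[nk _] _].
  by apply/ltW/psi_gt0; rewrite (leq_trans (ltnW n1)).
have [m m_gt0 psim] := deficit_bounded psi_gt0 psi_sum1 psi_moment2.
(* Positivity of [C N] is available for large [N] only. *)
have C_gt0 : \forall N \near \oo, 0 < C N by exact: cvgry_gt.
have CV0 : (C N)^-1 @[N --> \oo] --> 0 by apply/gtr0_cvgV0.
have err0 : (1 - (2 * m * (C N)^-1 + Num.sqrt (2^-1 * (C N)^-1)))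
    @[N --> \oo] --> (1 : R).
  rewrite -[X in _ --> X]subr0; apply: cvgB; first exact: cvg_cst.
  rewrite -[X in _ --> X]addr0; apply: cvgD.
    by rewrite -[X in _ --> X](mulr0 (2 * m)); exact: cvgMr.
  rewrite -(sqrtr0 R) -[X in Num.sqrt X](mulr0 2^-1).
  apply: continuous_cvg; first exact: sqrt_continuous.
  exact: cvgMr.
have errE : (1 - (2 * m * (C N)^-1 + Num.sqrt (2^-1 * (C N)^-1)))%:E
    @[N --> \oo] --> 1%E by apply: cvg_EFin => //; exact: nearW.
(* Squeezed between the estimate, which tends to 1, and 1 itself, for all [N >= 1] with [C N]
   positive. *)
apply: (squeeze_cvge _ errE); last exact: cvg_cst.
near=> N.
have N1 : (1 <= N)%N by near: N; exists 1%N.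
apply/andP; split.
  have CN_gt0 : 0 < C N by near: N.
  exact: hitting_time_estimate psim N1 CN_gt0 (X_nps N N1).
have [mX rcont _] := X_nps N N1.
by apply: probability_le1; exact: measurable_hitting_time_itv.
Unshelve. all: by end_near. Qed.
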